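(* Fix an integer $k\ge 7$. Then there exists $d_0$ such that for every $d\ge d_0$ there is a super-Kirkman $d$-polytope with exactly $d+k$ vertices.
   Context: A $d$-polytope is super-Kirkman if every two distinct facets intersect in a $(d-2)$-face of the polytope. *)

(* Defs.v *)
From HB Require Import structures.
From mathcomp Require Import all_boot all_order all_algebra.
From mathcomp Require Import boolp classical_sets functions cardinality reals.

Set Implicit Arguments.
Unset Strict Implicit.
Unset Printing Implicit Defensive.

Import Order.TTheory GRing.Theory Num.Theory.

Local Open Scope classical_set_scope.
Local Open Scope ring_scope.

Section Polytopes.
Variables (R : realType) (n : nat).
Implicit Types (A F G P S : set 'rV[R]_n) (d j : int).

Definition affine_hull A : set 'rV[R]_n :=
  [set x | exists (m : nat) (p : 'I_m -> 'rV[R]_n) (w : 'I_m -> R),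
     [/\ forall i, A (p i), \sum_i w i = 1 & x = \sum_i w i *: p i]].

Definition convex_hull A : set 'rV[R]_n :=
  [set x | exists (m : nat) (p : 'I_m -> 'rV[R]_n) (w : 'I_m -> R),
     [/\ forall i, A (p i), forall i, 0 <= w i, \sum_i w i = 1
       & x = \sum_i w i *: p i]].

(* The dimension of a set is that of its affine hull, i.e. of the direction
   space U of the affine hull p + U; the empty set has dimension -1. *)
Definition has_dim A d : Prop :=
  (A = set0 /\ d = -1) \/
  exists (p : 'rV[R]_n) (U : {vspace 'rV[R]_n}),
    affine_hull A = [set p + u | u in [set u | u \in U]] /\ d = (\dim U)%:Z.

Definition is_polytope P : Prop :=
  exists2 S, finite_set S & P = convex_hull S.

Definition d_polytope d P : Prop := is_polytope P /\ has_dim P d.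

(* Taking c = 0 yields the improper faces: P itself (b = 0) and the empty
   face (b = 1). *)
Definition is_face P F : Prop :=
  exists (c : 'cV[R]_n) (b : R),
    (forall x, P x -> (x *m c) 0 0 <= b) /\
    F = P `&` [set x | (x *m c) 0 0 = b].

Definition j_face j P F : Prop := is_face P F /\ has_dim F j.

Definition vertices P : set 'rV[R]_n := [set v | j_face 0 P [set v]].

Definition facet P F : Prop := exists2 d, has_dim P d & j_face (d - 1) P F.

Definition super_kirkman d P : Prop :=
  d_polytope d P /\
  forall F G, facet P F -> facet P G -> F <> G -> j_face (d - 2) P (F `&` G).

End Polytopes.

(* Main.v *)
Require Import Defs.
From mathcomp Require Import all_boot all_order all_algebra.
From mathcomp Require Import boolp classical_sets functions cardinality reals.
From mathcomp Require Import ring lra zify.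

(* Work with cones: a polytope is given by homogeneous coordinates of its
   vertices together with its slack matrix.  The join of two super-Kirkman
   polytopes is again super-Kirkman, its slack matrix being block diagonal, and
   the excess N - r of the number N of vertices over the rank r = d + 1 is
   additive under joins; a point has excess 0, so pyramids raise the dimension
   at constant excess.  The product of two simplices of dimensions a, b >= 2 is
   super-Kirkman of excess ab, which gives the excesses 4, 6 and 9, and the
   fractional matching polytope of K4 (dimension 6, 14 vertices, 10 facets) is
   super-Kirkman of excess 7.  Every integer k - 1 >= 6 is a sum of these. *)

Set Implicit Arguments.
Unset Strict Implicit.
Unset Printing Implicit Defensive.

Import Order.TTheory GRing.Theory Num.Theory.

Local Open Scope classical_set_scope.
Local Open Scope ring_scope.

(** * Convex and affine hulls of finite families of points *)

Lemma sum_enum_val (V : finType) (M : nmodType) (f : V -> M) :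
  \sum_(i < #|V|) f (enum_val i) = \sum_v f v.
Proof. by rewrite [RHS](reindex _ (onW_bij _ (@enum_val_bij V))). Qed.

Section Hulls.
Variables (R : realType) (n : nat) (V : finType) (p : V -> 'rV[R]_n).
Implicit Types (A B : set 'rV[R]_n) (F : set V) (c h : 'cV[R]_n).

Definition ev c (v : V) : R := (p v *m c) 0 0.

Lemma evD c c' v : ev (c + c') v = ev c v + ev c' v.
Proof. by rewrite /ev mulmxDr mxE. Qed.

Lemma evN c v : ev (- c) v = - ev c v.
Proof. by rewrite /ev mulmxN mxE. Qed.

Lemma evZ a c v : ev (a *: c) v = a * ev c v.
Proof. by rewrite /ev -scalemxAr mxE. Qed.

Lemma ev_sum I (r : seq I) (P : pred I) (f : I -> 'cV[R]_n) v :
  ev (\sum_(i <- r | P i) f i) v = \sum_(i <- r | P i) ev (f i) v.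
Proof. by rewrite /ev mulmx_sumr summxE. Qed.

Lemma lincomb_ev (I : finType) (w : I -> R) (f : I -> V) c :
  ((\sum_i w i *: p (f i)) *m c) 0 0 = \sum_i w i * ev c (f i).
Proof.
rewrite mulmx_suml summxE; apply: eq_bigr => i _.
by rewrite -scalemxAl mxE.
Qed.

Lemma affine_comb_const m (q : 'I_m -> 'rV[R]_n) (w : 'I_m -> R) y :
  (forall i, q i = y) -> \sum_i w i = 1 -> \sum_i w i *: q i = y.
Proof.
by move=> qE w1; under eq_bigr do rewrite qE; rewrite -scaler_suml w1 scale1r.
Qed.

Lemma convex_hull_imageE F x :
  convex_hull [set p v | v in F] x <->
  exists w : V -> R, [/\ forall v, 0 <= w v, forall v, ~ F v -> w v = 0,
    \sum_v w v = 1 & x = \sum_v w v *: p v].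
Proof.
split=> [[m [q [w [Fq w0 w1 ->]]]]|[w [w0 wF w1 ->]]].
  have /choice[f Ff] : forall i, exists v, F v /\ p v = q i.
    by move=> i; have [v] := Fq i; exists v.
  exists (fun v => \sum_(i | f i == v) w i); split.
  - by move=> v; apply: sumr_ge0.
  - move=> v nFv; rewrite big_pred0// => i; apply: contra_notF nFv.
    by move=> /eqP <-; case: (Ff i).
  - by rewrite -w1 (partition_big f xpredT).
  - rewrite (partition_big f xpredT)//=; apply: eq_bigr => v _.
    rewrite scaler_suml; apply: eq_bigr => i /eqP <-.
    by case: (Ff i) => _ ->.
have [v0 Fv0] : exists v, F v.
  apply: contrapT => nF; move: w1; rewrite big1 => [/eqP|v _].
    by rewrite eq_sym oner_eq0.
  by apply: wF => Fv; apply: nF; exists v.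
(* The hull needs a family lying in [F]; indices outside [F] carry weight 0, so sending them to [v0]
   changes nothing. *)
pose f v := if `[< F v >] then v else v0.
exists #|V|, (fun i => p (f (enum_val i))), (fun i => w (enum_val i)); split.
- move=> i; exists (f (enum_val i)) => //.
  by rewrite /f; case: asboolP.
- by [].
- by rewrite sum_enum_val.
- rewrite (sum_enum_val (fun v => w v *: p (f v))).
  apply: eq_bigr => v _; rewrite /f; case: asboolP => // /wF ->.
  by rewrite !scale0r.
Qed.

Lemma convex_hullS A B : A `<=` B -> convex_hull A `<=` convex_hull B.
Proof.
by move=> AB x [m [q [w [Aq ? ? ?]]]]; exists m, q, w; split=> // i; apply: AB.
Qed.

Lemma affine_hullS A B : A `<=` B -> affine_hull A `<=` affine_hull B.
Proof.
by move=> AB x [m [q [w [Aq ? ?]]]]; exists m, q, w; split=> // i; apply: AB.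
Qed.

Lemma sub_affine_hull A : A `<=` affine_hull A.
Proof.
move=> x Ax; exists 1%N, (fun _ => x), (fun _ => 1).
by split=> //; rewrite big_ord1// scale1r.
Qed.

Lemma sub_convex_hull A : A `<=` convex_hull A.
Proof.
move=> x Ax; exists 1%N, (fun _ => x), (fun _ => 1).
by split=> //; rewrite big_ord1// scale1r.
Qed.

Lemma affine_hull0 : affine_hull set0 = set0 :> set 'rV[R]_n.
Proof.
rewrite -subset0 => x [[|m] [q [w [Aq w1 _]]]]; last exact: Aq ord0.
by move: w1; rewrite big_ord0 => /eqP; rewrite eq_sym oner_eq0.
Qed.

(** Direction spaces consist of differences of points of the affine hulls, so they are nested
    whatever base points were chosen. *)
Lemma has_dimS A B d d' : A `<=` B -> has_dim A d -> has_dim B d' -> d <= d'.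
Proof.
move=> AB [[A0 ->]|[q [U [AU ->]]]] [[B0 ->]|[q' [U' [BU ->]]]] //.
- have : affine_hull A q.
    by rewrite AU; exists 0; rewrite ?addr0//; apply: mem0v.
  by move=> /(affine_hullS AB); rewrite B0 affine_hull0.
- have inU' u : u \in U -> exists2 u', u' \in U' & q + u = q' + u'.
    move=> uU; have : affine_hull A (q + u) by rewrite AU; exists u.
    by move=> /(affine_hullS AB); rewrite BU => -[u' /= u'U <-]; exists u'.
  rewrite lez_nat; apply: dimvS; apply/subvP => u /inU'[u1 u1U e1].
  have [u2 u2U e2] := inU' 0 (mem0v _).
  suff -> : u = u1 - u2 by rewrite memvB.
  apply: (addrI q); rewrite addrA e1 -[in RHS](addr0 q) e2.
  by rewrite addrAC addrK.
Qed.

Lemma has_dim_inj A d d' : has_dim A d -> has_dim A d' -> d = d'.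
Proof.
by move=> dA d'A; apply/eqP; rewrite eq_le !(@has_dimS A A _ _ (fun=> id)).
Qed.

End Hulls.

(** * Dimension of a hull computed from its annihilator *)

Section HullDim.
Variables (R : realType) (n : nat) (V : finType) (p : V -> 'rV[R]_n).
Variable h : 'cV[R]_n.
Hypothesis h1 : forall v, ev p h v = 1.

(** Injectivity of [y] ↦ [D *m y] makes [x] ↦ [x *m D] surjective onto R^m; its kernel, the
    direction space, has dimension [n - m] by rank-nullity. *)
Lemma has_dim_ker m (D : 'M[R]_(n, m)) (A : set 'rV[R]_n) q :
    (forall y : 'cV_m, D *m y = 0 -> y = 0) ->
    affine_hull A = [set x | (x - q) *m D = 0] ->
  has_dim A (n%:Z - m%:Z).
Proof.
move=> D0 AE; pose f := linfun (mulmxr D : 'rV[R]_n -> 'rV[R]_m).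
right; exists q, (lker f); split.
  rewrite AE; apply/seteqP; split=> x /=.
    move=> xD; exists (x - q); last by rewrite addrC subrK.
    by rewrite /= memv_ker lfunE /= xD.
  move=> [u /=]; rewrite memv_ker lfunE /= => /eqP uD <-.
  by rewrite addrC addKr.
have fullD : row_full D.
  rewrite /row_full -mxrank_tr -/(row_free D^T); apply: inj_row_free => y yD.
  by apply: trmx_inj; rewrite trmx0; apply: D0; apply: trmx_inj;
    rewrite trmx_mul trmxK yD trmx0.
have fT : limg f = fullv.
  apply/eqP; rewrite eqEsubv subvf; apply/subvP => y _.
  have -> : y = f (y *m pinvmx D) by rewrite lfunE /= -mulmxA mulVpmx// mulmx1.
  exact: memv_img (memvf _).
have := limg_ker_dim f fullv; rewrite capfv fT !dimvf !dim_matrix !mul1r.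
by move=> e; rewrite -[X in X%:Z - _]e PoszD addrK.
Qed.

(** The columns of [C] form a basis of the annihilator of the points, which therefore span a space
    of dimension [n - m]; the hyperplane [h = 1] cuts off one more dimension. The bound [m < n]
    forces [F] to be nonempty. *)
Lemma has_dim_hull (F : set V) m (C : 'M[R]_(n, m)) :
    (forall v, F v -> p v *m C = 0) ->
    (forall c, (forall v, F v -> ev p c v = 0) -> exists y, c = C *m y) ->
    (forall y : 'cV_m, C *m y = 0 -> y = 0) -> (m < n)%N ->
  has_dim (convex_hull [set p v | v in F]) (n%:Z - m%:Z - 1).
Proof.
move=> CF annF C0 ltmn.
have [v0 Fv0] : exists v, F v.
  apply: contrapT => nF.
  suff : (n <= m)%N by rewrite leqNgt ltmn.
  have fC : row_full C^T.
    rewrite -sub1mx; apply/row_subP => i.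
    have [v Fv|y cy] := annF (row i (1%:M : 'M[R]_n))^T.
      by case: nF; exists v.
    by apply/submxP; exists y^T; rewrite -trmx_mul -cy trmxK.
  by rewrite -(eqP fC) rank_leq_row.
have -> : n%:Z - m%:Z - 1 = n%:Z - (m + 1)%N%:Z by lia.
(* The affine hull is cut out by [x *m C = 0] and [x *m h = 1], so the equation matrix is [C] with
   [h] appended. *)
apply: (@has_dim_ker _ (row_mx C h) _ (p v0)) => [y|].
  rewrite -[y]vsubmxK mul_row_col => e.
  have d0 : dsubmx y = 0.
    move: e; rewrite [dsubmx y]mx11_scalar mul_mx_scalar.
    move=> /(congr1 (mulmx (p v0))); rewrite mulmxDr mulmxA CF// mul0mx add0r.
    rewrite -scalemxAr mulmx0 => /(congr1 (fun M : 'M_1 => M 0 0)).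
    rewrite [LHS]mxE -/(ev p h v0) h1 mulr1 [RHS]mxE => ->.
    by rewrite raddf0.
  have u0 : usubmx y = 0 by apply: C0; move: e; rewrite d0 mulmx0 addr0.
  by rewrite u0 d0 col_mx0.
have pvh v : p v *m h = 1%:M by rewrite [LHS]mx11_scalar -/(ev p h v) h1.
have qD k (q : 'I_k -> 'rV_n) (w : 'I_k -> R) :
    (forall i, q i *m row_mx C h = row_mx 0 1%:M) -> \sum_i w i = 1 ->
    (\sum_i w i *: q i) *m row_mx C h = row_mx 0 1%:M.
  move=> qE w1; rewrite mulmx_suml -[RHS]scale1r -[X in _ = X *: _]w1.
  rewrite scaler_suml.
  by apply: eq_bigr => i _; rewrite -scalemxAl qE.
have pD v : F v -> p v *m row_mx C h = row_mx 0 1%:M.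
  by move=> Fv; rewrite mul_mx_row CF// pvh.
apply/seteqP; split=> x.
  move=> [k [q [w [Fq w1 ->]]]] /=; apply/eqP; rewrite mulmxBl subr_eq0 pD//.
  apply/eqP/qD => // i; have [k' [q' [w' [Fq' _ w1' ->]]]] := Fq i.
  by apply: qD => // j; have [v Fv <-] := Fq' j; apply: pD.
move=> /eqP; rewrite mulmxBl subr_eq0 pD// mul_mx_row => /eqP/eq_row_mx[xC xh].
pose A := \matrix_(i < #|V|)
  (if `[< F (enum_val i) >] then p (enum_val i) else 0).
(* Double annihilator: each column of the cokernel of [A] kills the points of [F], hence factors
   through [C], which [x] kills. *)
have /submxP[y xE] : (x <= A)%MS.
  have colM k l (B : 'M[R]_(k, n)) (B' : 'M[R]_(n, l)) j :
    col j (B *m B') = B *m col j B' by rewrite !colE mulmxA.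
  rewrite submxE; apply/eqP/trmx_inj/row_matrixP => j.
  rewrite -!tr_col colM.
  have [v Fv|z ->] := annF (col j (cokermx A)).
    have := mulmx_coker A => /(congr1 (fun M => row (enum_rank v) (col j M))).
    rewrite colM row_mul rowK enum_rankK asboolT//.
    move=> /(congr1 (fun M : 'M_1 => M 0 0)); rewrite /ev => ->.
    by rewrite !mxE.
  by rewrite mulmxA xC mul0mx !linear0.
pose w v := if `[< F v >] then y 0 (enum_rank v) else 0.
have {}xE : x = \sum_v w v *: p v.
  rewrite xE mulmx_sum_row -[RHS]sum_enum_val; apply: eq_bigr => i _.
  by rewrite rowK /w enum_valK; case: asboolP => // _; rewrite scaler0 scale0r.
(* Evaluating [h] turns the linear combination into an affine one. *)
have w1 : \sum_v w v = 1.
  have := lincomb_ev p w id h; rewrite -xE xh mxE eqxx mulr1n => e.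
  rewrite [RHS]e.
  by apply: eq_bigr => v _; rewrite h1 mulr1.
apply: affine_hullS (@sub_convex_hull _ _ _) _ _.
exists #|V|, (fun i => if `[< F (enum_val i) >] then p (enum_val i) else p v0),
  (fun i => w (enum_val i)); split.
- by move=> i; case: asboolP => ?; [exists (enum_val i)|exists v0].
- by rewrite sum_enum_val.
- rewrite [LHS]xE -[LHS]sum_enum_val; apply: eq_bigr => i _.
  by rewrite /w; case: asboolP => // _; rewrite !scale0r.
Qed.
End HullDim.

(** * Faces as zero sets of nonnegative linear functionals *)

Section Face.
Variables (R : realType) (n : nat) (V : finType) (p : V -> 'rV[R]_n).

(** A convex combination of nonnegative values is zero only if every point of positive weight has
    value zero. *)
Lemma hull_zero_set (F : set V) g :
    (forall v, F v -> 0 <= ev p g v) ->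
  convex_hull [set p v | v in F] `&` [set x | (x *m g) 0 0 = 0] =
  convex_hull [set p v | v in [set v | F v /\ ev p g v = 0]].
Proof.
move=> g0; apply/seteqP; split=> x.
  move=> [/convex_hull_imageE[w [w0 wF w1 xE]] /= xg].
  apply/convex_hull_imageE; exists w; split=> // v nZ.
  have [Fv|/wF//] := pselect (F v).
  apply/eqP; apply: contrapT => /negP wv; apply: nZ; split=> //=.
  move: xg; rewrite xE (lincomb_ev p w id) => /psumr_eq0P.
  move=> /(_ _ v erefl) /eqP; rewrite mulf_eq0 (negPf wv) /=.
  move=> /(_ _)/eqP; apply.
  move=> u _; have [Fu|/wF->] := pselect (F u); last by rewrite mul0r.
  by rewrite mulr_ge0// g0.
move=> hx; split.
  by apply: convex_hullS hx => _ [v [Fv _] <-]; exists v.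
have /convex_hull_imageE[w [w0 wF w1 ->]] := hx.
rewrite /= (lincomb_ev p w id) big1// => v _.
have [[_ ->]|/wF->] := pselect (F v /\ ev p g v = 0); first by rewrite mulr0.
by rewrite mul0r.
Qed.

Lemma is_face_zero_set g : (forall v, 0 <= ev p g v) ->
  is_face (convex_hull (range p))
    (convex_hull [set p v | v in [set v | ev p g v = 0]]).
Proof.
move=> g0; exists (- g), 0; split.
  move=> x /convex_hull_imageE[w [w0 _ _ ->]].
  rewrite (lincomb_ev p w id) -oppr_ge0 -sumrN sumr_ge0// => v _.
  by rewrite evN mulrN opprK mulr_ge0.
have -> : [set v | ev p g v = 0] = [set v | setT v /\ ev p g v = 0].
  by apply/seteqP; split=> v //= [].
rewrite -(@hull_zero_set setT)//; congr (_ `&` _); apply/seteqP.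
have xN x : (x *m - g) 0 0 = - (x *m g) 0 0 by rewrite mulmxN mxE.
split=> x /=; rewrite xN; first by move=> ->; rewrite oppr0.
by move=> /eqP; rewrite oppr_eq0 => /eqP.
Qed.

(** Homogenization: where [h = 1], the inequality [c <= b] says that the linear functional
    [b *: h - c] is nonnegative. *)
Lemma is_faceE h F : (forall v, ev p h v = 1) ->
    is_face (convex_hull (range p)) F ->
  exists2 g, (forall v, 0 <= ev p g v) &
    F = convex_hull [set p v | v in [set v | ev p g v = 0]].
Proof.
move=> h1 [c [b [cb ->]]]; have g0 v : 0 <= ev p (b *: h - c) v.
  rewrite evD evN evZ h1 mulr1 subr_ge0; apply: cb.
  by apply: sub_convex_hull; exists v.
exists (b *: h - c) => //.
have -> : [set v | ev p (b *: h - c) v = 0] =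
    [set v | setT v /\ ev p (b *: h - c) v = 0].
  by apply/seteqP; split=> v //= [].
rewrite -(@hull_zero_set setT)//; apply/seteqP.
have hx x : convex_hull (range p) x ->
    (x *m (b *: h - c)) 0 0 = b - (x *m c) 0 0.
  move=> /convex_hull_imageE[w [_ _ w1 ->]].
  rewrite mulmxBr mxE [X in _ + X]mxE -scalemxAr mxE (lincomb_ev p w id h).
  by rewrite (eq_bigr w) ?w1 ?mulr1// => v _; rewrite h1 mulr1.
split=> x [Px] /= e; split=> //=; first by rewrite hx// e subrr.
by apply/esym/eqP; rewrite -subr_eq0 -hx// e.
Qed.

End Face.

(* Points p v in the hyperplane h = 1 of R^r, spanning R^r, and linear
   functionals with values s _ w at these points which generate the cone of
   functionals nonnegative at all points; config_ridge says, dually, that the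
   zero set of two facet functionals spans a subspace of codimension 2. *)
Record kirkman_config (R : realType) (r : nat) (V W : finType)
    (p : V -> 'rV[R]_r) (s : V -> W -> R) : Prop := KirkmanConfig {
  slack_linear : forall w, exists c, forall v, ev p c v = s v w;
  slack_ge0 : forall v w, 0 <= s v w;
  config_height : exists h, forall v, ev p h v = 1;
  config_full : forall c, (forall v, ev p c v = 0) -> c = 0;
  config_farkas : forall c, (forall v, 0 <= ev p c v) ->
    exists2 l : W -> R, (forall w, 0 <= l w) &
      forall v, ev p c v = \sum_w l w * s v w;
  config_ridge : forall w w' c,
    (forall v, s v w = 0 -> s v w' = 0 -> ev p c v = 0) ->
    exists a b, forall v, ev p c v = a * s v w + b * s v w';
  config_vertex : forall v v', v != v' ->
    exists2 w, s v w = 0 & s v' w != 0;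
  config_facet : forall w w', w != w' ->
    exists2 v, s v w = 0 & s v w' != 0;
  config_proper : forall w, exists v, s v w != 0 }.

(** * From a configuration to a super-Kirkman polytope *)

Section Config.
Variables (R : realType) (r : nat) (V W : finType).
Variables (p : V -> 'rV[R]_r) (s : V -> W -> R).
Hypotheses (K : kirkman_config p s) (r_gt2 : (2 < r)%N).

Let P := convex_hull (range p).
(** The diagonal case [Fw w w] is the facet of [w]; the others are the ridges. *)
Let Fw w w' := convex_hull [set p v | v in [set v | s v w = 0 /\ s v w' = 0]].

Lemma config_ext c c' : (forall v, ev p c v = ev p c' v) -> c = c'.
Proof.
move=> e; apply/eqP; rewrite -subr_eq0; apply/eqP/(config_full K) => v.
by rewrite evD evN e subrr.
Qed.

Lemma config_has_dim : has_dim P (r%:Z - 1).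
Proof.
have [h h1] := config_height K.
have -> : r%:Z - 1 = r%:Z - 0%N%:Z - 1 by rewrite subr0.
apply: (has_dim_hull h1 (C := 0 : 'M_(r, 0))).
- by move=> v _; rewrite mulmx0.
- move=> c c0; exists 0; rewrite mulmx0; apply: (config_full K) => v.
  exact: c0.
- by move=> y _; apply/matrixP => -[].
- exact: ltn_trans r_gt2.
Qed.

(** By [config_ridge] the functionals of [w] and [w'] span the annihilator of their common zeros,
    and [config_facet] makes them independent: evaluating a relation where just one of them vanishes
    kills the other's coefficient. *)
Lemma ridge_has_dim w w' : w != w' -> has_dim (Fw w w') (r%:Z - 3).
Proof.
move=> ww'; have [h h1] := config_height K.
have [c cw] := slack_linear K w; have [c' cw'] := slack_linear K w'.
have -> : r%:Z - 3 = r%:Z - (1 + 1)%N%:Z - 1 by lia.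
have mulE (y : 'cV[R]_(1 + 1)) :
    row_mx c c' *m y = usubmx y 0 0 *: c + dsubmx y 0 0 *: c'.
  by rewrite -{1}[y]vsubmxK mul_row_col [usubmx y in LHS]mx11_scalar
     [dsubmx y in LHS]mx11_scalar !mul_mx_scalar.
apply: (has_dim_hull h1 (C := row_mx c c')) => //.
- move=> v [vw vw']; rewrite mul_mx_row [X in row_mx X]mx11_scalar.
  rewrite [X in row_mx _ X]mx11_scalar -/(ev p c v) -/(ev p c' v) cw vw cw' vw'.
  by rewrite raddf0 row_mx0.
- move=> d d0; have [|a [b ab]] := @config_ridge _ _ _ _ _ _ K w w' d.
    by move=> v vw vw'; apply: d0.
  exists (col_mx a%:M b%:M); rewrite mulE col_mxKu col_mxKd !mxE eqxx !mulr1n.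
  by apply: config_ext => v; rewrite ab evD !evZ cw cw'.
- move=> y; rewrite mulE => cy.
  have e v : usubmx y 0 0 * s v w + dsubmx y 0 0 * s v w' = 0.
    by rewrite -cw -cw' -!evZ -evD cy /ev mulmx0 mxE.
  have [v vw vw'] := config_facet K ww'.
  have d0 : dsubmx y 0 0 = 0.
    move/eqP: (e v); rewrite vw mulr0 add0r mulf_eq0 (negPf vw') orbF.
    by move/eqP.
  rewrite eq_sym in ww'; have [v' vw0 vw0'] := config_facet K ww'.
  have u0 : usubmx y 0 0 = 0.
    move/eqP: (e v'); rewrite vw0 mulr0 addr0 mulf_eq0 (negPf vw0') orbF.
    by move/eqP.
  rewrite -[y]vsubmxK [usubmx y]mx11_scalar [dsubmx y]mx11_scalar u0 d0.
  by rewrite raddf0 col_mx0.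
Qed.

(** The sum of two nonnegative functionals vanishes exactly where both do. *)
Lemma ridge_is_face w w' : is_face P (Fw w w').
Proof.
have [c cw] := slack_linear K w; have [c' cw'] := slack_linear K w'.
have -> : Fw w w' = convex_hull [set p v | v in [set v | ev p (c + c') v = 0]].
  congr (convex_hull [set p v | v in _]); apply/seteqP; split=> v /=.
    by rewrite evD cw cw' => -[-> ->]; rewrite addr0.
  rewrite evD cw cw' => /eqP; rewrite paddr_eq0 ?(slack_ge0 K)//.
  by move=> /andP[/eqP ? /eqP].
apply: is_face_zero_set => v; rewrite evD cw cw'.
by rewrite addr_ge0 ?(slack_ge0 K).
Qed.

Lemma facet_capE w w' : Fw w w `&` Fw w' w' = Fw w w'.
Proof.
have [c cw] := slack_linear K w'.
have e : Fw w w' = convex_hull [set p v | v in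
    [set v | [set v | s v w = 0 /\ s v w = 0] v /\ ev p c v = 0]].
  congr (convex_hull [set p v | v in _]).
  by apply/seteqP; split=> v /=; rewrite cw; tauto.
apply/seteqP; split=> x.
  move=> [xw /convex_hull_imageE[l [_ lF _ xE]]].
  rewrite e -hull_zero_set => [|v _]; last by rewrite cw (slack_ge0 K).
  split=> //=; rewrite xE (lincomb_ev p l id) big1// => v _.
  have [[vw _]|/lF->] := pselect (s v w' = 0 /\ s v w' = 0).
    by rewrite cw vw mulr0.
  by rewrite mul0r.
by move=> hx; split; apply: convex_hullS hx => _ [v [] ? ? <-]; exists v.
Qed.

(** Expand the functional of the face by [config_farkas]. With no positive multiplier the face is
    all of [P], too large for a facet; with two it lies in a ridge, too small. So exactly one
    multiplier is positive. *)
Lemma facetE F : facet P F -> exists w, F = Fw w w.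
Proof.
have [h h1] := config_height K.
move=> [d dP [/(is_faceE h1)[g g0 ->] dF]].
have {dP} dE : d = r%:Z - 1 := has_dim_inj dP config_has_dim.
have [l l0 lE] := config_farkas K g0.
have gE v w : 0 < l w -> ev p g v = 0 -> s v w = 0.
  move=> lw; rewrite lE => e.
  have ls u : true -> 0 <= l u * s v u by rewrite mulr_ge0 ?(slack_ge0 K).
  have /eqP := psumr_eq0P ls e (i := w) isT.
  by rewrite mulf_eq0 gt_eqF// => /eqP.
have [[w lw]|nl] := pselect (exists w, 0 < l w); last first.
  have : r%:Z - 1 <= d - 1.
    apply: has_dimS config_has_dim dF; apply: convex_hullS => _ [v _ <-].
    exists v => //=; rewrite lE big1// => w _; apply/eqP; rewrite mulf_eq0.
    rewrite eq_le l0 andbT leNgt; apply/orP; left; apply/negP => lw.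
    by apply: nl; exists w.
  by rewrite dE; lia.
exists w; congr (convex_hull [set p v | v in _]); apply/seteqP; split=> v /=.
  by move=> /(gE _ _ lw).
move=> [vw _]; rewrite lE big1// => w' _.
have [->|ww'] := eqVneq w' w; first by rewrite vw mulr0.
have [lw'|lw'] := ltP 0 (l w'); last first.
  by rewrite (_ : l w' = 0) ?mul0r//; apply/eqP; rewrite eq_le lw' l0.
have : d - 1 <= r%:Z - 3.
  apply: has_dimS dF (ridge_has_dim ww'); apply: convex_hullS => _ [u u0 <-].
  by exists u => //; split; apply: gE u0.
by rewrite dE; lia.
Qed.

(** A one-point face is the hull of the points in a zero set, so it is one of the [p v]. Conversely,
    [p v] is exposed by a sum of generators. *)
Lemma vertices_config : vertices P = range p.
Proof.
have [h h1] := config_height K; apply/seteqP; split=> x.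
  move=> [/(is_faceE h1)[g g0 xE] _].
  have : [set x] x by [].
  rewrite xE => /convex_hull_imageE[w [_ wF w1 _]].
  have [v Fv] : exists v, ev p g v = 0.
    apply: contrapT => nF; move: w1; rewrite big1 => [/eqP|v _].
      by rewrite eq_sym oner_eq0.
    by apply: wF => Fv; apply: nF; exists v.
  exists v => //; have : [set x] (p v); last by [].
  by rewrite xE; apply: sub_convex_hull; exists v.
move=> [v _ <-]; split.
  have /choice[c cE] := slack_linear K.
  (* By [config_vertex], every [u] other than [v] lies off some facet through [v], so [g] vanishes
     only at [v]. *)
  pose g := \sum_(w | s v w == 0) c w.
  have gE u : ev p g u = \sum_(w | s v w == 0) s u w.
    by rewrite ev_sum; apply: eq_bigr.
  have -> : [set p v] = convex_hull [set p v | v in [set v | ev p g v = 0]].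
    have -> : [set u | ev p g u = 0] = [set v].
      apply/seteqP; split=> u /=; last first.
        by move=> ->; rewrite gE big1// => w /eqP.
      rewrite gE => e; apply/eqP; apply: contrapT => /negP.
      rewrite eq_sym => /(config_vertex K)[w vw] /eqP; apply.
      by apply: psumr_eq0P e _ _ => [w' _|]; [exact: (slack_ge0 K)|rewrite vw].
    rewrite image_set1; apply/seteqP; split=> y; first exact: sub_convex_hull.
    move=> [m [q [w [qE _ w1 ->]]]] /=.
    exact: affine_comb_const.
  apply: is_face_zero_set => u; rewrite gE sumr_ge0// => w _.
  exact: (slack_ge0 K).
right; exists (p v), 0%VS; rewrite dimv0; split=> //.
apply/seteqP; split=> y.
  move=> [m [q [w [qE w1 ->]]]] /=; exists 0; first exact: mem0v.
  by rewrite addr0 (affine_comb_const qE).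
move=> [u /=]; rewrite memv0 => /eqP -> <-; rewrite addr0.
exact: sub_affine_hull.
Qed.

Lemma config_inj : injective p.
Proof.
move=> v v' e; apply/eqP; apply: contrapT => /negP /(config_vertex K)[w vw].
by have [c cw] := slack_linear K w; rewrite -cw /ev -e -/(ev p c v) cw vw eqxx.
Qed.

Lemma config_super_kirkman :
  super_kirkman (r%:Z - 1) P /\ (vertices P #= `I_#|V|)%card.
Proof.
split; last first.
  rewrite vertices_config; apply: card_eq_trans.
    by apply: inj_card_eq => v v' _ _; exact: config_inj.
  have -> : `I_#|V| = [set nat_of_ord (enum_rank v) | v in [set: V]].
    apply/seteqP; split=> [i iV|_ [v _ <-]]; last exact: ltn_ord.
    by exists (enum_val (Ordinal iV)); rewrite // enum_valK.
  apply/card_esym/inj_card_eq => v v' _ _ e.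
  exact/enum_rank_inj/val_inj.
split.
  split; last exact: config_has_dim.
  by exists (range p) => //; exact: finite_image.
move=> F G /facetE[w ->] /facetE[w' ->] FG.
have ww' : w != w' by apply/eqP => e; apply: FG; rewrite e.
rewrite facet_capE; split; first exact: ridge_is_face.
by rewrite (_ : _ - 2 = r%:Z - 3); [exact: ridge_has_dim|lia].
Qed.

End Config.

(** * Joins, points and simplices *)

Definition has_kirkman_config (R : realType) (r N : nat) : Prop :=
  exists (V W : finType) (p : V -> 'rV[R]_r) (s : V -> W -> R),
    kirkman_config p s /\ #|V| = N.

Section Join.
Variables (R : realType) (r1 r2 : nat) (V1 V2 W1 W2 : finType).
Variables (p1 : V1 -> 'rV[R]_r1) (s1 : V1 -> W1 -> R).
Variables (p2 : V2 -> 'rV[R]_r2) (s2 : V2 -> W2 -> R).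

Definition join_point (v : V1 + V2) : 'rV[R]_(r1 + r2) :=
  match v with inl v1 => row_mx (p1 v1) 0 | inr v2 => row_mx 0 (p2 v2) end.

Definition join_slack (v : V1 + V2) (w : W1 + W2) : R :=
  match v, w with
  | inl v1, inl w1 => s1 v1 w1
  | inr v2, inr w2 => s2 v2 w2
  | _, _ => 0
  end.

Lemma ev_join_col c1 c2 v : ev join_point (col_mx c1 c2) v =
  match v with inl v1 => ev p1 c1 v1 | inr v2 => ev p2 c2 v2 end.
Proof. by case: v => v; rewrite /ev /= mul_row_col mul0mx ?addr0 ?add0r. Qed.

Lemma ev_join c v : ev join_point c v =
  match v with
  | inl v1 => ev p1 (usubmx c) v1
  | inr v2 => ev p2 (dsubmx c) v2
  end.
Proof. by rewrite -{1}[c]vsubmxK ev_join_col. Qed.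

Hypotheses (K1 : kirkman_config p1 s1) (K2 : kirkman_config p2 s2).

(* The constant function 1 is a combination of the columns of the slack matrix,
   so no row of the slack matrix vanishes. *)
Lemma slack_row_neq0 r (V W : finType) (p : V -> 'rV[R]_r) (s : V -> W -> R) :
  kirkman_config p s -> forall v, exists w, s v w != 0.
Proof.
move=> K v; have [h h1] := config_height K.
have [|l _ lE] := config_farkas K (c := h) => [u|]; first by rewrite h1.
apply: contrapT => nw; have := lE v; rewrite h1 big1 => [/eqP|w _].
  by rewrite oner_eq0.
apply/eqP; rewrite mulf_eq0; apply/orP; right; apply: contrapT => ?.
by apply: nw; exists w; apply/negP.
Qed.

Lemma join_config : kirkman_config join_point join_slack.
Proof.
have [h1 h1E] := config_height K1; have [h2 h2E] := config_height K2.
split.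
- case=> w.
    have [c cE] := slack_linear K1 w; exists (col_mx c 0) => -[] v.
      by rewrite ev_join_col cE.
    by rewrite ev_join_col /ev mulmx0 mxE.
  have [c cE] := slack_linear K2 w; exists (col_mx 0 c) => -[] v.
    by rewrite ev_join_col /ev mulmx0 mxE.
  by rewrite ev_join_col cE.
- by case=> v [] w //=; [exact: (slack_ge0 K1)|exact: (slack_ge0 K2)].
- by exists (col_mx h1 h2) => -[] v; rewrite ev_join_col.
- move=> c c0; rewrite -[c]vsubmxK.
  rewrite (config_full K1 (c := usubmx c)) => [|v].
    rewrite (config_full K2 (c := dsubmx c)) ?col_mx0// => v.
    by rewrite -(c0 (inr v)) ev_join.
  by rewrite -(c0 (inl v)) ev_join.
- move=> c c0.
  have [|l1 l10 l1E] := config_farkas K1 (c := usubmx c) => [v|].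
    by have := c0 (inl v); rewrite ev_join.
  have [|l2 l20 l2E] := config_farkas K2 (c := dsubmx c) => [v|].
    by have := c0 (inr v); rewrite ev_join.
  exists (fun w => match w with inl w => l1 w | inr w => l2 w end).
    by case.
  case=> v; rewrite ev_join big_sumType /=.
    by rewrite [X in _ + X]big1 ?addr0// => w _; rewrite mulr0.
  by rewrite [X in X + _]big1 ?add0r// => w _; rewrite mulr0.
- move=> w w' c c0; have c1 v := c0 (inl v); have c2 v := c0 (inr v).
  case: w w' c1 c2 {c0} => w [] w' /= c1 c2.
  + have [v vw vw'|a [b ab]] :=
        config_ridge K1 (w := w) (w' := w') (c := usubmx c).
      by rewrite -[LHS](ev_join c (inl v)) c1.
    exists a, b; case=> v /=; first by rewrite ev_join ab.
    by rewrite c2// !mulr0 addr0.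
  (* With the facets in different factors, each half of [c] vanishes on a single facet; the ridge
     condition with [w = w'] then makes it a multiple of that facet's functional. *)
  + have [v vw _|a [b ab]] :=
        config_ridge K1 (w := w) (w' := w) (c := usubmx c).
      by rewrite -[LHS](ev_join c (inl v)) c1.
    have [v vw _|d [e de]] :=
        config_ridge K2 (w := w') (w' := w') (c := dsubmx c).
      by rewrite -[LHS](ev_join c (inr v)) c2.
    exists (a + b), (d + e); case=> v; rewrite ev_join /=.
      by rewrite ab mulr0 addr0 mulrDl.
    by rewrite de mulr0 add0r mulrDl.
  + have [v vw _|a [b ab]] :=
        config_ridge K1 (w := w') (w' := w') (c := usubmx c).
      by rewrite -[LHS](ev_join c (inl v)) c1.
    have [v vw _|d [e de]] :=
        config_ridge K2 (w := w) (w' := w) (c := dsubmx c).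
      by rewrite -[LHS](ev_join c (inr v)) c2.
    exists (d + e), (a + b); case=> v; rewrite ev_join /=.
      by rewrite ab mulr0 add0r mulrDl.
    by rewrite de mulr0 addr0 mulrDl.
  + have [v vw vw'|a [b ab]] :=
        config_ridge K2 (w := w) (w' := w') (c := dsubmx c).
      by rewrite -[LHS](ev_join c (inr v)) c2.
    exists a, b; case=> v /=; last by rewrite ev_join ab.
    by rewrite c1// !mulr0 addr0.
- case=> v [] v' vv'.
  + have [|w ? ?] := config_vertex K1 (v := v) (v' := v') _; first by [].
    by exists (inl w).
  (* Functionals of one factor vanish on the other, so it is enough to find one that is nonzero at
     [v']. *)
  + by have [w ?] := slack_row_neq0 K2 v'; exists (inr w).
  + by have [w ?] := slack_row_neq0 K1 v'; exists (inl w).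
  + have [|w ? ?] := config_vertex K2 (v := v) (v' := v') _; first by [].
    by exists (inr w).
- case=> w [] w' ww'.
  + have [|v ? ?] := config_facet K1 (w := w) (w' := w') _; first by [].
    by exists (inl v).
  + by have [v ?] := config_proper K2 w'; exists (inr v).
  + by have [v ?] := config_proper K1 w'; exists (inl v).
  + have [|v ? ?] := config_facet K2 (w := w) (w' := w') _; first by [].
    by exists (inr v).
- case=> w.
  + by have [v ?] := config_proper K1 w; exists (inl v).
  + by have [v ?] := config_proper K2 w; exists (inr v).
Qed.

End Join.

Lemma has_join (R : realType) r1 N1 r2 N2 :
    has_kirkman_config R r1 N1 -> has_kirkman_config R r2 N2 ->
  has_kirkman_config R (r1 + r2) (N1 + N2).
Proof.
move=> [V1 [W1 [p1 [s1 [K1 <-]]]]] [V2 [W2 [p2 [s2 [K2 <-]]]]].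
exists (V1 + V2)%type, (W1 + W2)%type, (join_point p1 p2), (join_slack s1 s2).
by split; [exact: join_config|rewrite card_sum].
Qed.

(** The cone over a point is a ray, generated by the height itself; that generator vanishes at no
    vertex, so its facet is the empty face. *)
Lemma has_point (R : realType) : has_kirkman_config R 1 1.
Proof.
exists unit, unit, (fun=> 1%:M), (fun _ _ => 1); split; last exact: card_unit.
have ev1 (c : 'cV[R]_1) v : ev (fun _ : unit => 1%:M) c v = c 0 0.
  by rewrite /ev mul1mx.
split=> //.
- by exists 1%:M => v; rewrite ev1 mxE eqxx.
- by exists 1%:M => v; rewrite ev1 mxE eqxx.
- by move=> c /(_ tt); rewrite ev1 => c0; rewrite [c]mx11_scalar c0 raddf0.
- move=> c /(_ tt); rewrite ev1 => c0; exists (fun=> c 0 0) => // v.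
  by rewrite ev1 (big_pred1 tt) ?mulr1// => -[].
- by move=> _ _ c _; exists (c 0 0), 0 => v; rewrite ev1 mulr1 mul0r addr0.
- by move=> _; exists tt; exact: oner_neq0.
Qed.

Lemma has_points (R : realType) m : has_kirkman_config R m.+1 m.+1.
Proof.
elim: m => [|m ih]; first exact: has_point.
by rewrite -add1n; apply: has_join => //; exact: has_point.
Qed.


(** * Products of two simplices *)

Lemma exists_third (T : finType) (x y : T) :
  (2 < #|T|)%N -> exists2 z, z != x & z != y.
Proof.
move=> T2; have /card_gt0P[z] : (0 < #|predC (pred2 x y)|)%N.
  rewrite -(ltn_add2l #|pred2 x y|) cardC addn0 card2.
  by apply: leq_ltn_trans T2; case: (x != y).
by rewrite !inE negb_or => /andP[zx zy]; exists z.
Qed.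

Section SimplexProduct.
Variables (R : realType) (a b : nat).
Implicit Types (c : 'cV[R]_(a.+1 + b)).

(* Barycentric coordinates on both simplices, the redundant one (of index 0 in
   the second factor) being left out. *)
Definition prod_point (v : 'I_a.+1 * 'I_b.+1) : 'rV[R]_(a.+1 + b) :=
  row_mx (delta_mx 0 v.1)
    (if unlift ord0 v.2 is Some j then delta_mx 0 j else 0).

Definition prod_slack (v : 'I_a.+1 * 'I_b.+1) (w : 'I_a.+1 + 'I_b.+1) : R :=
  match w with inl i => (v.1 == i)%:R | inr j => (v.2 == j)%:R end.

(** Functionals on the product are sums of a function of each index; [B ord0 = 0] fixes the constant
    that could move between the two. *)
Lemma ev_prod_split c : exists A B,
  [/\ forall v, ev prod_point c v = A v.1 + B v.2, B ord0 = 0,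
      forall i, usubmx c i 0 = A i & forall j, dsubmx c j 0 = B (lift ord0 j)].
Proof.
exists (fun i => usubmx c i 0),
  (fun j => if unlift ord0 j is Some j' then dsubmx c j' 0 else 0).
split=> [v||//|j]; last 2 first.
- by rewrite unlift_none.
- by rewrite liftK.
rewrite /ev /prod_point -{1}[c]vsubmxK mul_row_col mxE -rowE mxE.
by case: (unlift ord0 v.2) => [j|]; rewrite ?mul0mx -?rowE !mxE.
Qed.

Lemma ev_prod_join (A : 'I_a.+1 -> R) (B : 'I_b.+1 -> R) :
  exists c, forall v, ev prod_point c v = A v.1 + B v.2.
Proof.
(* The missing coordinate of index 0 is compensated by moving [B ord0] into the first factor, whose
   coordinates sum to 1. *)
exists (col_mx (\col_i (A i + B ord0)) (\col_j (B (lift ord0 j) - B ord0))).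
move=> v; rewrite /ev /prod_point mul_row_col.
case: unliftP => [j ->|->]; rewrite -!rowE ?mul0mx !mxE ?addr0//.
by rewrite -addrA [B ord0 + _]addrC subrK.
Qed.

Lemma sum_prod_slack (l : 'I_a.+1 + 'I_b.+1 -> R) v :
  \sum_w l w * prod_slack v w = l (inl v.1) + l (inr v.2).
Proof.
rewrite big_sumType /=; congr (_ + _).
  rewrite (bigD1 v.1)//= eqxx mulr1 big1 ?addr0// => i /negPf.
  by rewrite eq_sym => ->; rewrite mulr0.
rewrite (bigD1 v.2)//= eqxx mulr1 big1 ?addr0// => i /negPf.
by rewrite eq_sym => ->; rewrite mulr0.
Qed.

(** A third row [i3] forces [B] to be constant, so the sum depends on [i] alone and is supported on
    [i1] and [i2]. *)
Lemma add_fun_ridge_same (I J : finType) (A : I -> R) (B : J -> R) i1 i2 :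
    (2 < #|I|)%N ->
    (forall i j, i != i1 -> i != i2 -> A i + B j = 0) ->
  exists x y, forall i j, A i + B j = x * (i == i1)%:R + y * (i == i2)%:R.
Proof.
move=> I2 AB; have [i3 i31 i32] := exists_third i1 i2 I2.
(* The factor [(i1 != i2)%:R] avoids counting the row twice when [i1 = i2]. *)
exists (A i1 - A i3), ((i1 != i2)%:R * (A i2 - A i3)) => i j.
have Bj : B j = - A i3 by apply/eqP; rewrite -addr_eq0 addrC AB.
have [->|ni1] := eqVneq i i1.
  by rewrite Bj; case: eqVneq => _; rewrite ?mulr1 ?mul0r ?mulr0 ?addr0.
have [ei2|ni2] := eqVneq i i2.
  by rewrite Bj ei2 eq_sym -ei2 ni1 ei2 mulr0 add0r mul1r mulr1.
by rewrite AB// !mulr0 addr0.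
Qed.

(** Off [i1] and [j1] both functions are constant, with opposite values; only the deviations at [i1]
    and [j1] remain. *)
Lemma add_fun_ridge_mixed (I J : finType) (A : I -> R) (B : J -> R) i1 j1 :
    (2 < #|I|)%N -> (2 < #|J|)%N ->
    (forall i j, i != i1 -> j != j1 -> A i + B j = 0) ->
  exists x y, forall i j, A i + B j = x * (i == i1)%:R + y * (j == j1)%:R.
Proof.
move=> I2 J2 AB; have [i2 i21 _] := exists_third i1 i1 I2.
have [j2 j21 _] := exists_third j1 j1 J2.
have Aj i : i != i1 -> A i = - B j2.
  by move=> ?; apply/eqP; rewrite -addr_eq0 AB.
have Bj j : j != j1 -> B j = B j2.
  by move=> ?; apply: (addrI (A i2)); rewrite !AB.
exists (A i1 + B j2), (B j1 - B j2) => i j.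
have [->|/Aj->] := eqVneq i i1; have [->|/Bj->] := eqVneq j j1;
  rewrite ?eqxx /=; ring.
Qed.

Hypotheses (a_gt1 : (1 < a)%N) (b_gt1 : (1 < b)%N).

Lemma prod_config : kirkman_config prod_point prod_slack.
Proof.
have Ia : (2 < #|'I_a.+1|)%N by rewrite card_ord.
have Ib : (2 < #|'I_b.+1|)%N by rewrite card_ord.
split.
- case=> [i|j].
    have [c cE] := ev_prod_join (fun i' => (i' == i)%:R) (fun=> 0).
    by exists c => v; rewrite cE addr0.
  have [c cE] := ev_prod_join (fun=> 0) (fun j' => (j' == j)%:R).
  by exists c => v; rewrite cE add0r.
- by move=> v [i|j] /=; rewrite ler0n.
- have [c cE] := ev_prod_join (fun=> 1) (fun=> 0).
  by exists c => v; rewrite cE addr0.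
- move=> c c0; have [A [B [cE B0 cA cB]]] := ev_prod_split c.
  have A0 i : A i = 0 by rewrite -[A i]addr0 -B0 -[LHS](cE (i, ord0)) c0.
  rewrite -[c]vsubmxK -col_mx0; congr col_mx; apply/matrixP => i j.
    by rewrite ord1 cA A0 mxE.
  rewrite ord1 cB mxE; have := c0 (ord0, lift ord0 i).
  by rewrite cE /= A0 add0r.
- move=> c c0; have [A [B [cE _ _ _]]] := ev_prod_split c.
  (* Moving the minimum [A m] from [A] to [B] makes both parts nonnegative: [B j + A m] is the value
     of [c] at the vertex [(m, j)]. *)
  have [m _ mA] := @arg_minP _ _ _ ord0 xpredT A isT.
  exists (fun w => match w with inl i => A i - A m | inr j => B j + A m end).
    case=> [i|j]; first by rewrite subr_ge0 mA.
    by rewrite addrC; have := c0 (m, j); rewrite cE.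
  by move=> v; rewrite sum_prod_slack cE addrACA addNr addr0.
- move=> w w' c c0; have [A [B [cE _ _ _]]] := ev_prod_split c.
  case: w w' c0 => [i1|j1] [i2|j2] c0.
  + have [|x [y xy]] := @add_fun_ridge_same _ _ A B i1 i2 Ia.
      by move=> i j /negPf ni1 /negPf ni2; rewrite -(cE (i, j)) c0//= ?ni1 ?ni2.
    by exists x, y => v; rewrite cE xy.
  + have [|x [y xy]] := @add_fun_ridge_mixed _ _ A B i1 j2 Ia Ib.
      by move=> i j /negPf ni1 /negPf ni2; rewrite -(cE (i, j)) c0//= ?ni1 ?ni2.
    by exists x, y => v; rewrite cE xy.
  + have [|x [y xy]] := @add_fun_ridge_mixed _ _ A B i2 j1 Ia Ib.
      by move=> i j /negPf ni1 /negPf ni2; rewrite -(cE (i, j)) c0//= ?ni1 ?ni2.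
    by exists y, x => v; rewrite cE xy addrC.
  + have [|x [y xy]] := @add_fun_ridge_same _ _ B A j1 j2 Ib.
      move=> j i /negPf ni1 /negPf ni2; rewrite addrC -(cE (i, j)) c0//=.
        by rewrite ni1.
      by rewrite ni2.
    by exists x, y => v; rewrite cE addrC xy.
- move=> [i j] [i' j']; rewrite xpair_eqE negb_and => /orP[] /negPf ne.
    by exists (inl i') => /=; rewrite ?ne ?eqxx ?oner_neq0.
  by exists (inr j') => /=; rewrite ?ne ?eqxx ?oner_neq0.
- case=> [i1|j1] [i2|j2] ne.
  + have /negPf n : i2 != i1 by apply: contraNneq ne => ->.
    by exists (i2, ord0) => /=; rewrite ?n ?eqxx ?oner_neq0.
  + have [i /negPf ni _] := exists_third i1 i1 Ia.
    by exists (i, j2) => /=; rewrite ?ni ?eqxx ?oner_neq0.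
  + have [j /negPf nj _] := exists_third j1 j1 Ib.
    by exists (i2, j) => /=; rewrite ?nj ?eqxx ?oner_neq0.
  + have /negPf n : j2 != j1 by apply: contraNneq ne => ->.
    by exists (ord0, j2) => /=; rewrite ?n ?eqxx ?oner_neq0.
- case=> [i|j]; first by exists (i, ord0); rewrite /= eqxx oner_neq0.
  by exists (ord0, j); rewrite /= eqxx oner_neq0.
Qed.

End SimplexProduct.

Lemma has_simplex_product (R : realType) a b : (1 < a)%N -> (1 < b)%N ->
  has_kirkman_config R (a.+1 + b) (a.+1 * b.+1).
Proof.
move=> a1 b1; exists ('I_a.+1 * 'I_b.+1)%type, ('I_a.+1 + 'I_b.+1)%type.
exists (@prod_point R a b), (@prod_slack R a b).
split; first exact: prod_config.
by rewrite card_prod !card_ord.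
Qed.

(** * Certifying full rank by integer elimination *)

Section IntegerElimination.
Variable n : nat.
Implicit Types (u w : seq int) (us : seq (seq int)).

(** Written with [foldr] so that [vm_compute] can evaluate it. *)
Definition int_dot u w : int :=
  foldr +%R 0 (mkseq (fun j => u`_j * w`_j) n).

(** Cross-multiplication in place of division keeps the rows integral. *)
Definition int_comb (a : int) u (b : int) w : seq int :=
  mkseq (fun j => a * u`_j - b * w`_j) n.

(* One step of Gauss-Jordan elimination on column j; the first component
   collects the pivot rows. *)
Definition eliminate (j : nat) (st : seq (seq int) * seq (seq int)) :=
  let p := nth [::] st.2 (find (fun u => u`_j != 0) st.2) in
  let reduce u := int_comb p`_j u u`_j p in
  (p :: map reduce st.1, map reduce st.2).

(** The test is a certificate: for each [j] it looks for a collected row supported on [j] alone, so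
    no correctness of the pivoting is presupposed. *)
Definition full_rank us : bool :=
  let ps := (foldr eliminate ([::], us) (iota 0 n)).1 in
  all (fun j => has (fun u => (u`_j != 0) &&
    all (fun i => (i == j) || (u`_i == 0)) (iota 0 n)) ps) (iota 0 n).

Variable R : realType.
Implicit Type x : 'cV[R]_n.

Definition row_dot u x : R := \sum_(j < n) (u`_j)%:~R * x j 0.

Lemma row_dot_int u w :
  row_dot u (\col_j (w`_j)%:~R) = (int_dot u w)%:~R.
Proof.
rewrite /int_dot foldrE big_map -[X in iota 0 X]subn0 big_mkord rmorph_sum /=.
by apply: eq_bigr => j _; rewrite mxE rmorphM.
Qed.

Lemma row_dot_comb a u b w x :
  row_dot (int_comb a u b w) x = a%:~R * row_dot u x - b%:~R * row_dot w x.
Proof.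
rewrite /row_dot !mulr_sumr -sumrB; apply: eq_bigr => j _.
by rewrite nth_mkseq// rmorphB !rmorphM mulrBl !mulrA.
Qed.

(** Elimination only forms combinations of rows, so [x] stays orthogonal to all of them; a row
    supported on [j] alone then gives [x j 0 = 0]. *)
Lemma full_rankP us x : full_rank us ->
  (forall u, u \in us -> row_dot u x = 0) -> x = 0.
Proof.
move=> /allP full us0.
pose vanish us' := forall u, u \in us' -> row_dot u x = 0.
have inv js : let st := foldr eliminate ([::], us) js in
    vanish st.1 /\ vanish st.2.
  elim: js => [//|j js [v1 v2]]; set st := foldr _ _ js in v1 v2 *.
  have p0 : row_dot (nth [::] st.2 (find (fun u => u`_j != 0) st.2)) x = 0.
    (* If no pivot exists, [nth] returns the empty row, whose entries all read as 0. *)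
    have [lt|ge] := ltnP (find (fun u => u`_j != 0) st.2) (size st.2).
      by apply: v2; rewrite mem_nth.
    by rewrite nth_default// /row_dot big1// => i _; rewrite nth_nil mul0r.
  split=> u /=.
    rewrite inE => /predU1P[->//|/mapP[w /v1 w0 ->]].
    by rewrite row_dot_comb p0 w0 !mulr0 subrr.
  by move=> /mapP[w /v2 w0 ->]; rewrite row_dot_comb p0 w0 !mulr0 subrr.
apply/matrixP => j k; rewrite ord1 mxE.
have /full/hasP[u /(inv _).1 u0 /andP[uj /allP ui]] : val j \in iota 0 n.
  by rewrite mem_iota ltn_ord.
move: u0; rewrite /row_dot (bigD1 j)//= big1 => [|i ij].
  by rewrite addr0 => /eqP; rewrite mulf_eq0 intr_eq0 (negPf uj) => /eqP.
have /ui : val i \in iota 0 n by rewrite mem_iota ltn_ord.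
by rewrite -[_ == _]/(i == j) (negPf ij) => /eqP ->; rewrite mul0r.
Qed.

End IntegerElimination.

(** * The fractional matching polytope of K4 *)

Section FractionalMatchingK4.
Variable R : realType.

(* The fractional matching polytope of K4: nonnegative edge weights with total
   at most 1 at every vertex of K4.  Its vertices are the ten matchings and the
   four half-triangles.  A row lists the homogenizing coordinate and the weights
   of the edges 12, 34, 13, 24, 14, 23, up to a common factor. *)
Definition k4_matchings : seq (seq int) :=
  [:: [:: 1; 0; 0; 0; 0; 0; 0];
      [:: 1; 1; 0; 0; 0; 0; 0];
      [:: 1; 0; 1; 0; 0; 0; 0];
      [:: 1; 0; 0; 1; 0; 0; 0];
      [:: 1; 0; 0; 0; 1; 0; 0];
      [:: 1; 0; 0; 0; 0; 1; 0];
      [:: 1; 0; 0; 0; 0; 0; 1];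
      [:: 1; 1; 1; 0; 0; 0; 0];
      [:: 1; 0; 0; 1; 1; 0; 0];
      [:: 1; 0; 0; 0; 0; 1; 1];
      [:: 2; 1; 0; 1; 0; 0; 1];
      [:: 2; 1; 0; 0; 1; 1; 0];
      [:: 2; 0; 1; 1; 0; 1; 0];
      [:: 2; 0; 1; 0; 1; 0; 1]].

(* The weights of the six edges and the slacks at the vertices 1, 2, 3, 4. *)
Definition k4_functionals : seq (seq int) :=
  [:: [:: 0; 1; 0; 0; 0; 0; 0];
      [:: 0; 0; 1; 0; 0; 0; 0];
      [:: 0; 0; 0; 1; 0; 0; 0];
      [:: 0; 0; 0; 0; 1; 0; 0];
      [:: 0; 0; 0; 0; 0; 1; 0];
      [:: 0; 0; 0; 0; 0; 0; 1];
      [:: 1; -1; 0; -1; 0; -1; 0];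
      [:: 1; -1; 0; 0; -1; 0; -1];
      [:: 1; 0; -1; -1; 0; 0; -1];
      [:: 1; 0; -1; 0; -1; -1; 0]].

Definition k4_row (v : nat) : seq int := nth [::] k4_matchings v.
(** The slack times the positive homogenizing coordinate: sign and vanishing are kept and become
    computable. *)
Definition k4_int_slack (v w : nat) : int :=
  int_dot 7 (k4_row v) (nth [::] k4_functionals w).

Definition k4_point (v : 'I_14) : 'rV[R]_7 :=
  \row_j (((k4_row v)`_j)%:~R / ((k4_row v)`_0)%:~R).
Definition k4_slack (v : 'I_14) (w : 'I_10) : R :=
  (k4_int_slack v w)%:~R / ((k4_row v)`_0)%:~R.

Lemma ord_all n (P : pred nat) : all P (iota 0 n) -> forall i : 'I_n, P i.
Proof. by move=> /allP h i; apply: h; rewrite mem_iota ltn_ord. Qed.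

Lemma k4_row_gt0 (v : 'I_14) : 0 < ((k4_row v)`_0)%:~R :> R.
Proof.
rewrite ltr0z; move: v; apply: (@ord_all _ (fun v => 0 < (k4_row v)`_0)).
by vm_compute.
Qed.

Lemma ev_k4 c (v : 'I_14) :
  ev k4_point c v = row_dot (k4_row v) c / ((k4_row v)`_0)%:~R.
Proof.
rewrite /ev mxE /row_dot mulr_suml; apply: eq_bigr => j _.
by rewrite mxE mulrAC.
Qed.

Lemma k4_slack_linear w : exists c, forall v, ev k4_point c v = k4_slack v w.
Proof.
exists (\col_j ((nth [::] k4_functionals w)`_j)%:~R) => v.
by rewrite ev_k4 row_dot_int.
Qed.

Lemma k4_slack_eq0 v w : (k4_slack v w == 0) = (k4_int_slack v w == 0).
Proof. by rewrite mulf_eq0 invr_eq0 intr_eq0 (gt_eqF (k4_row_gt0 v)) orbF. Qed.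

(* Fourier-Motzkin elimination of one variable. *)
Lemma seq_between (l0 : R) (L U : seq R) :
    all (fun l => all (fun u => l <= u) U) (l0 :: L) ->
  exists p, all (fun l => l <= p) (l0 :: L) && all (fun u => p <= u) U.
Proof.
elim: L l0 => [|l1 L ih] l0.
  by move=> /= /andP[lU _]; exists l0; rewrite lexx.
rewrite [all _ _]/= => /andP[l0U /ih[p /andP[Lp pU]]].
have [l0p|/ltW pl0] := leP l0 p; first by exists p; rewrite /= l0p; apply/andP.
exists l0; rewrite l0U andbT /= lexx /=; have /andP[l1p lp] := Lp.
by rewrite (le_trans l1p)//=; apply: sub_all lp => l /le_trans; apply.
Qed.

(* Linear programming duality for K4: a functional nonnegative at the vertices
   of the fractional matching polytope is certified by a fractional vertex
   cover p, whose entries become the multipliers of the vertex slacks. *)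
Lemma k4_cover (t a a' b b' d d' : R) :
    0 <= t -> 0 <= t + a -> 0 <= t + a' -> 0 <= t + b -> 0 <= t + b' ->
    0 <= t + d -> 0 <= t + d' -> 0 <= t + a + a' -> 0 <= t + b + b' ->
    0 <= t + d + d' -> 0 <= t + (a + b + d') / 2 -> 0 <= t + (a + b' + d) / 2 ->
    0 <= t + (a' + b + d) / 2 -> 0 <= t + (a' + b' + d') / 2 ->
  exists p1 p2 p3 p4, [/\ [/\ 0 <= p1, 0 <= p2, 0 <= p3 & 0 <= p4],
    [/\ 0 <= a + p1 + p2, 0 <= a' + p3 + p4 & 0 <= b + p1 + p3],
    [/\ 0 <= b' + p2 + p4, 0 <= d + p1 + p4 & 0 <= d' + p2 + p3] &
    p1 + p2 + p3 + p4 = t].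
Proof.
move=> *.
(* Put [p4 = t - p1 - p2 - p3]. Pairing lower with upper bounds of [p3] gives those of [p2], and
   pairing again those of [p1]; the lists are these projections, solved in reverse order. *)
have [|p1] := @seq_between 0
  [:: - (t + b + d); - (t + a + d); - (t + a + b); - (t + a + b + d) / 2]
  [:: t + b'; t + d'; t; t + a'; t + (b' + d') / 2; 2 * t + b' + d' + d;
      2 * t + b' + d' + b; t + (a' + b' + d') / 2].
  by rewrite /=; do ! (apply/andP; split); rewrite //; lra.
rewrite /= !andbT => p1B.
have [|p2] := @seq_between 0 [:: - a - p1; p1 - (t + b' + d')]
  [:: t - p1; t + d; t + b; t + b + d + p1; t + a' - p1].
  by rewrite /=; move: p1B; do ! (case/andP=> ?); move=> *;
    do ! (apply/andP; split); rewrite //; lra.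
rewrite /= !andbT => p2B.
have [|p3] := @seq_between 0 [:: - b - p1; - d' - p2]
  [:: t - p1 - p2; t + b' - p1; t + d - p2].
  by rewrite /=; move: p1B p2B; do ! (case/andP=> ?); move=> *;
    do ! (apply/andP; split); rewrite //; lra.
rewrite /= !andbT => p3B.
exists p1, p2, p3, (t - p1 - p2 - p3); move: p1B p2B p3B.
by move=> *; split; [split; lra|split; lra|split; lra|ring].
Qed.

Lemma k4_farkas c : (forall v, 0 <= ev k4_point c v) ->
  exists2 l : 'I_10 -> R, (forall w, 0 <= l w) &
    forall v, ev k4_point c v = \sum_w l w * k4_slack v w.
Proof.
move=> c0; pose x (j : nat) : R := c (inord j) 0.
have val0 (v : 'I_14) : 0 <= row_dot (k4_row v) c.
  by have := c0 v; rewrite ev_k4 pmulr_lge0// invr_gt0 k4_row_gt0.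
have dotE u : row_dot u c = \sum_(0 <= j < 7) (u`_j)%:~R * x j.
  by rewrite big_mkord; apply: eq_bigr => j _; rewrite /x inord_val.
have val i : (i < 14)%N -> 0 <= \sum_(0 <= j < 7) ((k4_row i)`_j)%:~R * x j.
  by move=> lt14; rewrite -dotE; exact: (val0 (Ordinal lt14)).
have [||||||||||||||p1 [p2 [p3 [p4 [[p10 p20 p30 p40] [e1 e2 e3] [e4 e5 e6]
    ps]]]]] :=
  @k4_cover (x 0%N) (x 1%N) (x 2%N) (x 3%N) (x 4%N) (x 5%N) (x 6%N).
1-14: move: (val 0%N isT) (val 1%N isT) (val 2%N isT) (val 3%N isT)
  (val 4%N isT) (val 5%N isT) (val 6%N isT) (val 7%N isT) (val 8%N isT)
  (val 9%N isT) (val 10%N isT) (val 11%N isT) (val 12%N isT) (val 13%N isT);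
  rewrite !big_nat_recl// !big_geq//= => *; lra.
(* An edge gets its coefficient plus the cover values at its ends, cancelling the negative
   contributions of the vertex slacks; the constant term is the sum of the cover, [x 0]. *)
pose l (w : nat) := nth 0 [:: x 1%N + p1 + p2; x 2%N + p3 + p4; x 3%N + p1 + p3;
  x 4%N + p2 + p4; x 5%N + p1 + p4; x 6%N + p2 + p3; p1; p2; p3; p4] w.
exists l.
  apply: (@ord_all _ (fun w => 0 <= l w)).
  by rewrite /= /l /= e1 e2 e3 e4 e5 e6 p10 p20 p30 p40.
have xE j : (j < 7)%N ->
    x j = \sum_(0 <= w < 10) l w * ((nth [::] k4_functionals w)`_j)%:~R.
  rewrite !big_nat_recl// big_geq// /l /=.
  do 7 ! [case: j => [|j]; first by move=> _ /=; lra].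
  by [].
have cE : c = \sum_(w < 10) l w *: \col_j ((nth [::] k4_functionals w)`_j)%:~R.
  apply/matrixP => j k; rewrite summxE ord1.
  have -> : c j 0 = x j by rewrite /x inord_val.
  by rewrite xE// big_mkord; apply: eq_bigr => w _; rewrite !mxE.
move=> v; rewrite {1}cE ev_sum; apply: eq_bigr => w _.
by rewrite evZ ev_k4 row_dot_int.
Qed.

(* A vertex off the facet w and, unless w = w', on the facet w'. *)
Definition k4_off (w w' v : nat) : bool :=
  (k4_int_slack v w != 0) && ((w == w') || (k4_int_slack v w' == 0)).

Definition k4_witness (w w' : nat) : nat := find (k4_off w w') (iota 0 14).

(** The common zeros of [w] and [w'] with one extra vertex off each facet; if these span R^7, the
    common zeros have codimension at most 2. *)
Definition k4_ridge_span (w w' v1 v2 : nat) : seq nat :=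
  [seq v <- iota 0 14 | [|| (k4_int_slack v w == 0) && (k4_int_slack v w' == 0),
    v == v1 | v == v2]].

Lemma k4_witnessP (w w' : 'I_10) : exists v1 v2 : 'I_14,
  [/\ k4_off w w' v1, k4_off w' w v2, w = w' -> v1 = v2 &
      full_rank 7 (map k4_row (k4_ridge_span w w' v1 v2))].
Proof.
(* [find] returns 14 when no witness exists, hence the bound test. *)
have check : all (fun w => all (fun w' =>
    [&& (k4_witness w w' < 14)%N, k4_off w w' (k4_witness w w') &
        full_rank 7 (map k4_row
          (k4_ridge_span w w' (k4_witness w w') (k4_witness w' w)))])
    (iota 0 10)) (iota 0 10) by vm_compute.
have {}check i i' := ord_all (ord_all check i) i'.
have /and3P[v1 o1 full] := check w w'; have /and3P[v2 o2 _] := check w' w.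
exists (Ordinal v1), (Ordinal v2); split=> // ww'.
by apply: val_inj; move: ww' => /(congr1 val) /= ->.
Qed.

(** Subtract from [c] the combination that agrees with it at the two witnesses; the rest vanishes on
    a spanning set. *)
Lemma k4_ridge (w w' : 'I_10) c :
    (forall v, k4_slack v w = 0 -> k4_slack v w' = 0 -> ev k4_point c v = 0) ->
  exists a b, forall v, ev k4_point c v = a * k4_slack v w + b * k4_slack v w'.
Proof.
move=> c0.
have [u1 [u2 [/andP[o1 e1] /andP[o2 e2] u12 full]]] := k4_witnessP w w'.
have [d dE] := k4_slack_linear w; have [d' dE'] := k4_slack_linear w'.
have s1 : k4_slack u1 w != 0 by rewrite k4_slack_eq0.
have s2 : k4_slack u2 w' != 0 by rewrite k4_slack_eq0.
pose a := ev k4_point c u1 / k4_slack u1 w.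
(* For [w = w'] the witnesses coincide and [a] alone does the work. *)
pose b := (w != w')%:R * (ev k4_point c u2 / k4_slack u2 w').
exists a, b => v; rewrite -dE -dE' -!evZ -evD; apply/eqP.
rewrite -subr_eq0 -evN -evD.
rewrite (_ : c - _ = 0) ?/ev ?mulmx0 ?mxE//.
apply: (full_rankP full) => _ /mapP[v0 + ->].
rewrite mem_filter mem_iota => /andP[+ lt].
have {v lt} [v ->] : exists v : 'I_14, v0 = v :> nat.
  by exists (Ordinal (lt : (v0 < 14)%N)).
move=> vP.
suff /eqP : ev k4_point (c - (a *: d + b *: d')) v = 0.
  by rewrite ev_k4 mulf_eq0 invr_eq0 (gt_eqF (k4_row_gt0 v)) orbF => /eqP.
rewrite evD evN evD !evZ dE dE'.
case/or3P: vP => [/andP[z z']|/eqP vE|/eqP vE].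
- have /eqP sw : k4_slack v w == 0 by rewrite k4_slack_eq0.
  have /eqP sw' : k4_slack v w' == 0 by rewrite k4_slack_eq0.
  by rewrite sw sw' !mulr0 addr0 subr0 c0.
- have -> : v = u1 by apply: val_inj.
  rewrite /a divfK// /b; have [|ww'] := eqVneq w w'.
    by rewrite !mul0r addr0 subrr.
  have /eqP -> : k4_slack u1 w' == 0.
    by move: e1; rewrite k4_slack_eq0 -[_ == _ :> nat]/(w == w') (negPf ww').
  by rewrite mulr0 addr0 subrr.
- have -> : v = u2 by apply: val_inj.
  rewrite /b /a; have [ww'|ww'] := eqVneq w w'.
    by rewrite -(u12 ww') !mul0r addr0 divfK// subrr.
  have /eqP -> : k4_slack u2 w == 0.
    move: e2; rewrite k4_slack_eq0 eq_sym -[_ == _ :> nat]/(w == w').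
    by rewrite (negPf ww').
  by rewrite mulr0 add0r mul1r divfK// subrr.
Qed.

Lemma k4_config : kirkman_config k4_point k4_slack.
Proof.
have dec (Q : nat -> nat -> bool) m n :
    all (fun i => all (Q i) (iota 0 n)) (iota 0 m) ->
    forall (i : 'I_m) (j : 'I_n), Q i j.
  by move=> h i j; exact: (ord_all (ord_all h i) j).
split.
- exact: k4_slack_linear.
- move=> v w; rewrite divr_ge0 ?(ltW (k4_row_gt0 v))// ler0z; move: v w.
  by apply: (dec (fun v w => 0 <= k4_int_slack v w)); vm_compute.
(* The row of the empty matching is (1, 0, ..., 0); read as a functional, it is the homogenizing
   coordinate. *)
- exists (\col_j ((nth [::] k4_matchings 0)`_j)%:~R) => v.
  rewrite ev_k4 row_dot_int.
  have /eqP -> :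
      int_dot 7 (k4_row v) (nth [::] k4_matchings 0) == (k4_row v)`_0.
    move: v; apply: (@ord_all _ (fun v =>
      int_dot 7 (k4_row v) (nth [::] k4_matchings 0) == (k4_row v)`_0)).
    by vm_compute.
  by rewrite divff// gt_eqF// k4_row_gt0.
- move=> c c0; apply: (@full_rankP _ _ k4_matchings); first by vm_compute.
  move=> u /(nthP [::])[v lt <-]; have := c0 (Ordinal lt).
  rewrite ev_k4 => /eqP.
  by rewrite mulf_eq0 invr_eq0 (gt_eqF (k4_row_gt0 _)) orbF => /eqP.
- exact: k4_farkas.
- exact: k4_ridge.
- move=> v v' vv'.
  have := dec (fun v v' => (v == v') || has (fun w =>
    (k4_int_slack v w == 0) && (k4_int_slack v' w != 0)) (iota 0 10))
    14 14 _ v v'.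
  rewrite -[val v == val v']/(v == v') (negPf vv') => /(_ _)/hasP[|w].
    by vm_compute.
  rewrite mem_iota => w10 /andP[s1 s2].
  by exists (Ordinal (w10 : (w < 10)%N)); [apply/eqP|]; rewrite k4_slack_eq0.
- move=> w w' ww'.
  have := dec (fun w w' => (w == w') || has (fun v =>
    (k4_int_slack v w == 0) && (k4_int_slack v w' != 0)) (iota 0 14))
    10 10 _ w w'.
  rewrite -[val w == val w']/(w == w') (negPf ww') => /(_ _)/hasP[|v].
    by vm_compute.
  rewrite mem_iota => v14 /andP[s1 s2].
  by exists (Ordinal (v14 : (v < 14)%N)); [apply/eqP|]; rewrite k4_slack_eq0.
- move=> w; have := @ord_all 10 (fun w =>
    has (fun v => k4_int_slack v w != 0) (iota 0 14)) _ w.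
  move=> /(_ _)/hasP[|v]; first by vm_compute.
  rewrite mem_iota => v14 s1.
  by exists (Ordinal (v14 : (v < 14)%N)); rewrite k4_slack_eq0.
Qed.

End FractionalMatchingK4.

Lemma has_k4 (R : realType) : has_kirkman_config R 7 14.
Proof.
exists 'I_14, 'I_10, (k4_point R), (k4_slack R); split; first exact: k4_config.
exact: card_ord.
Qed.

(** * Assembling all excesses and the final polytope *)

Lemma has_excess (R : realType) e : (6 <= e)%N ->
  exists2 r, (2 < r)%N & has_kirkman_config R r (r + e).
Proof.
have prod a b : (1 < a)%N -> (1 < b)%N -> exists2 r, (2 < r)%N &
    has_kirkman_config R r (r + a * b).
  move=> a1 b1; exists (a.+1 + b)%N; first by lia.
  have -> : (a.+1 + b + a * b = a.+1 * b.+1)%N by lia.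
  exact: has_simplex_product.
have add e1 e2 : (exists2 r, (2 < r)%N & has_kirkman_config R r (r + e1)) ->
    (exists2 r, (2 < r)%N & has_kirkman_config R r (r + e2)) ->
    exists2 r, (2 < r)%N & has_kirkman_config R r (r + (e1 + e2)).
  move=> [r1 r12 K1] [r2 r22 K2]; exists (r1 + r2)%N; first by lia.
  by rewrite addnACA; exact: has_join.
have e4 := prod 2 2 isT isT.
(* From 10 on, split off a summand 4, leaving at least 6; the cases 6 = 2·3, 7 (K4), 8 = 4 + 4 and 9
   = 3·3 remain. *)
elim/ltn_ind: e => e ih e6; have [lt10|ge10] := ltnP e 10; last first.
  by rewrite -(@subnKC 4 e); [apply: add e4 (ih _ _ _)|]; lia.
have [->|ne6] := eqVneq e 6; first exact: (prod 2 3).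
have [->|ne7] := eqVneq e 7; first by exists 7; [|exact: has_k4].
have [->|ne8] := eqVneq e 8; first exact: (add 4 4 e4 e4).
have -> : e = 9 by lia.
exact: (prod 3 3).
Qed.

Unset Implicit Arguments.
Local Close Scope ring_scope.

Theorem theorem3p14 (R : realType) (k : nat) (hk : (7 <= k)%N) :
  exists d0 : nat, forall d : nat, (d0 <= d)%N ->
    exists (n : nat) (P : set 'rV[R]_n),
      super_kirkman d%:Z%R P /\ (vertices P #= `I_(d + k))%card.
Proof.
(* A [d]-polytope has rank [d + 1], so [d + k] vertices mean excess [k - 1]. *)
have [|r r2 K] := @has_excess R k.-1; first by lia.
(* Joining with a simplex on [d - r + 1] vertices raises the rank from [r] to [d + 1] at the same
   excess. *)
exists r => d rd.
have := has_join K (has_points R (d - r)).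
have -> : (r + k.-1 + (d - r).+1 = d + k)%N by lia.
have -> : (r + (d - r).+1 = d.+1)%N by lia.
move=> [V [W [p [s [{}K <-]]]]]; exists d.+1, (convex_hull (range p)).
have -> : d%:Z%R = (d.+1%:Z - 1)%R by lia.
by apply: config_super_kirkman K _; lia.
Qed.
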